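(* If an optimal solution $\mathbf{X}^*$ to the convex problem $\min_{\mathbf{X}\in\mathcal{F}_{n,k}} f(\mathbf{X})$ with $\mathrm{rank}(\mathbf{X}^* )=k$ satisfies strict complementarity for some corresponding dual solution, then $\lambda_{n-k}(\nabla f(\mathbf{X}^* ))-\lambda_{n-k+1}(\nabla f(\mathbf{X}^* ))>0$. Conversely, if an optimal solution $\mathbf{X}^*$ to this problem satisfies $\lambda_{n-k}(\nabla f(\mathbf{X}^* ))-\lambda_{n-k+1}(\nabla f(\mathbf{X}^* ))>0$, then it satisfies strict complementarity for every corresponding dual solution.
   Context: Let $1\le k<n$ be integers. $\mathbb{S}^n$ is the space of real symmetric $n\times n$ matrices with inner product $\langle \mathbf{A},\mathbf{B}\rangle=\mathrm{Tr}(\mathbf{A}\mathbf{B})$; $\|\cdot\|_F$ is the Frobenius norm; $\lambda_i(\mathbf{A})$ is the $i$-th largest eigenvalue of $\mathbf{A}\in\mathbb{S}^n$. The Fantope is $\mathcal{F}_{n,k}=\{\mathbf{X}\in\mathbb{S}^n : \mathbf{I}\succeq\mathbf{X}\succeq0,\ \mathrm{Tr}(\mathbf{X})=k\}$. $f:\mathbb{S}^n\to\mathbb{R}$ is convex, differentiable and $\beta$-smooth, $\beta>0$: $\|\nabla f(\mathbf{X})-\nabla f(\mathbf{Y})\|_F\le\beta\|\mathbf{X}-\mathbf{Y}\|_F$ for all $\mathbf{X},\mathbf{Y}$. The Lagrangian of the problem is $L(\mathbf{X},\mathbf{Z}_1,\mathbf{Z}_2,s)=f(\mathbf{X})-\langle\mathbf{Z}_1,\mathbf{X}\rangle-\langle\mathbf{Z}_2,\mathbf{I}-\mathbf{X}\rangle-s(\mathrm{Tr}(\mathbf{X})-k)$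 with dual variables $\mathbf{Z}_1\succeq0,\mathbf{Z}_2\succeq0$ in $\mathbb{S}^n$ and $s\in\mathbb{R}$. $\mathbf{X}^*$ and $(\mathbf{Z}_1^*,\mathbf{Z}_2^*,s^* )$ are corresponding optimal primal-dual solutions if and only if the KKT conditions hold: (1) $\mathbf{I}\succeq\mathbf{X}^*\succeq0$, $\mathrm{Tr}(\mathbf{X}^* )=k$, $\mathbf{Z}_1^*\succeq0$, $\mathbf{Z}_2^*\succeq0$; (2) $\nabla f(\mathbf{X}^* )=\mathbf{Z}_1^*-\mathbf{Z}_2^*+s^*\mathbf{I}$; (3) $\langle\mathbf{Z}_1^*,\mathbf{X}^*\rangle=\langle\mathbf{Z}_2^*,\mathbf{I}-\mathbf{X}^*\rangle=0$. Such a primal-dual pair satisfies strict complementarity if $\mathrm{range}(\mathbf{X}^* )=\mathrm{nullspace}(\mathbf{Z}_1^* )$ or $\mathrm{range}(\mathbf{I}-\mathbf{X}^* )=\mathrm{nullspace}(\mathbf{Z}_2^* )$. *)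

(* Defs.v *)
From HB Require Import structures.
From mathcomp Require Import all_boot all_order all_algebra.
From mathcomp Require Import sesquilinear spectral complex.
From mathcomp Require Import boolp classical_sets reals topology normedtype.
From mathcomp Require Import derive convex.
From mathcomp Require Import ring.

Set Implicit Arguments.
Unset Strict Implicit.
Unset Printing Implicit Defensive.

Import Order.TTheory GRing.Theory Num.Theory.
Import numFieldNormedType.Exports.

Local Open Scope classical_set_scope.
Local Open Scope ring_scope.

Record symmx (R : realType) (n : nat) := SymMx {
  symmx_val :> 'M[R]_n ;
  symmx_valP : symmx_val \is symmetricmx }.

Section SymmetricMatrices.
Variables (R : realType) (n : nat).
Local Notation S := (symmx R n).

Let symP (A : 'M[R]_n) : reflect (A^T = A) (A \is symmetricmx).
Proof.
by rewrite qualifE /= expr0 scale1r map_mx_id //; apply: (iffP eqP).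
Qed.

Definition symmx_pred : pred 'M[R]_n := fun A => A \is symmetricmx.

HB.instance Definition _ := [isSub of S for @symmx_val R n].
HB.instance Definition _ := [Choice of S by <:].

Fact symmx_submod : GRing.submod_closed symmx_pred.
Proof.
split=> [|a A B]; first by apply/symP; rewrite trmx0.
move=> /symP AE /symP BE; apply/symP.
by rewrite linearD linearZ /= AE BE.
Qed.
HB.instance Definition _ :=
  GRing.SubChoice_isSubLmodule.Build R 'M[R]_n _ S symmx_submod.

Fact symmx1_subproof : (1%:M : 'M[R]_n) \is symmetricmx.
Proof. by apply/symP; rewrite trmx1. Qed.
Definition symmx1 : S := SymMx symmx1_subproof.

Definition sym_dot (A B : S) : R := \tr (A *m B).

Definition frobenius_norm (A : S) : R := Num.sqrt (sym_dot A A).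

Lemma symmx_tr (A : S) : (A : 'M[R]_n)^T = A.
Proof. exact/symP/symmx_valP. Qed.

Lemma sym_dotE (A B : S) : sym_dot A B = \sum_i \sum_j A i j * B i j.
Proof.
rewrite /sym_dot /mxtrace; apply: eq_bigr => i _; rewrite mxE.
by apply: eq_bigr => j _; rewrite -{1}(symmx_tr B) mxE.
Qed.

Lemma sym_dotC (A B : S) : sym_dot A B = sym_dot B A.
Proof. exact: mxtrace_mulC. Qed.

Lemma sym_dotDl (A B C : S) : sym_dot (A + B) C = sym_dot A C + sym_dot B C.
Proof. by rewrite /sym_dot /= mulmxDl mxtraceD. Qed.

Lemma sym_dotZl a (A B : S) : sym_dot (a *: A) B = a * sym_dot A B.
Proof. by rewrite /sym_dot /= -scalemxAl mxtraceZ. Qed.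

Lemma sym_dot_ge0 (A : S) : 0 <= sym_dot A A.
Proof.
rewrite sym_dotE; apply: sumr_ge0 => i _; apply: sumr_ge0 => j _.
by rewrite -expr2 sqr_ge0.
Qed.

Lemma sym_dot_eq0 (A : S) : sym_dot A A = 0 -> A = 0.
Proof.
rewrite sym_dotE => /eqP; rewrite psumr_eq0; last first.
  by move=> i _; apply: sumr_ge0 => j _; rewrite -expr2 sqr_ge0.
move=> /allP A0; apply/val_inj/matrixP => i j /=; rewrite mxE.
have := A0 i (mem_index_enum _); rewrite psumr_eq0; last first.
  by move=> ? _; rewrite -expr2 sqr_ge0.
move=> /allP /(_ j (mem_index_enum _)).
by rewrite /= mulf_eq0 orbb => /eqP.
Qed.

Lemma frobenius_norm0_eq0 (A : S) : frobenius_norm A = 0 -> A = 0.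
Proof.
move/eqP; rewrite sqrtr_eq0 => A0; apply: sym_dot_eq0.
by apply/eqP; rewrite eq_le A0 sym_dot_ge0.
Qed.

Lemma frobenius_normZ a (A : S) : frobenius_norm (a *: A) = `|a| * frobenius_norm A.
Proof.
rewrite /frobenius_norm sym_dotZl sym_dotC sym_dotZl mulrA -expr2.
by rewrite sqrtrM ?sqr_ge0 // sqrtr_sqr.
Qed.

Lemma cauchy_schwarz (A B : S) :
  sym_dot A B <= frobenius_norm A * frobenius_norm B.
Proof.
set a := frobenius_norm A; set b := frobenius_norm B.
have a2 : sym_dot A A = a ^+ 2 by rewrite sqr_sqrtr ?sym_dot_ge0.
have b2 : sym_dot B B = b ^+ 2 by rewrite sqr_sqrtr ?sym_dot_ge0.
have [A0|A0] := eqVneq a 0.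
  rewrite A0 mul0r (frobenius_norm0_eq0 A0) -(scale0r (0 : S)).
  by rewrite sym_dotZl mul0r.
have [B0|B0] := eqVneq b 0.
  rewrite B0 mulr0 (frobenius_norm0_eq0 B0) sym_dotC -(scale0r (0 : S)).
  by rewrite sym_dotZl mul0r.
have ab_gt0 : 0 < a * b *+ 2.
  by rewrite mulrn_wgt0 // mulr_gt0 // lt_def ?A0 ?B0 sqrtr_ge0.
have := sym_dot_ge0 (b *: A + (- a) *: B).
have -> : sym_dot (b *: A + (- a) *: B) (b *: A + (- a) *: B)
          = (a * b *+ 2) * (a * b - sym_dot A B).
  rewrite sym_dotDl !sym_dotZl (sym_dotC A) (sym_dotC B) !sym_dotDl !sym_dotZl.
  by rewrite a2 b2 (sym_dotC B A); ring.
by rewrite pmulr_rge0 // subr_ge0.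
Qed.

Lemma frobenius_normD (A B : S) :
  frobenius_norm (A + B) <= frobenius_norm A + frobenius_norm B.
Proof.
rewrite -(@ler_pXn2r _ 2) ?nnegrE ?addr_ge0 ?sqrtr_ge0 //.
rewrite sqrrD !sqr_sqrtr ?sym_dot_ge0 // sym_dotDl.
rewrite (sym_dotC A) (sym_dotC B) !sym_dotDl (sym_dotC B A).
rewrite -addrA [leRHS]addrAC -addrA lerD2l [leRHS]addrC addrA lerD2r.
by rewrite -mulr2n lerMn2r cauchy_schwarz.
Qed.

(* Makes `|A| on symmx R n the Frobenius norm (on 'M[R]_n the library's norm is
   the entrywise maximum), with the induced topology and differential. *)
HB.instance Definition _ := Lmodule_isNormed.Build R S
  frobenius_normD frobenius_normZ frobenius_norm0_eq0.

End SymmetricMatrices.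

Section Spectrum.
Variables (R : realType) (n : nat).
Implicit Types (A B X Z : symmx R n).

Definition psd A : Prop := forall v : 'cV[R]_n, 0 <= (v^T *m A *m v) 0 0.

(* The eigenvalues with multiplicity, in nonincreasing order; the default
   [::] is never reached, by eigenvaluesP below. *)
Definition eigenvalues A : seq R :=
  xget [::] [set s : seq R | sorted >=%R s /\
    char_poly A = \prod_(x <- s) ('X - x%:P)].

(* 1-based: lambda_ 1 A is the largest eigenvalue of A. *)
Definition lambda_ (i : nat) A : R := nth 0 (eigenvalues A) i.-1.

Lemma eigenvaluesP A : sorted >=%R (eigenvalues A) /\
  char_poly A = \prod_(x <- eigenvalues A) ('X - x%:P).
Proof.
rewrite /eigenvalues.
suff [s Ps] : exists s : seq R, sorted >=%R s /\
    char_poly A = \prod_(x <- s) ('X - x%:P).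
  exact: (@xgetPex _ [::] [set s : seq R | sorted >=%R s /\
    char_poly A = \prod_(x <- s) ('X - x%:P)] (ex_intro _ s Ps)).
pose iota := real_complex R.
pose AC : 'M[R[i]]_n := map_mx iota A.
have conjR (x : R) : (iota x)^* = iota x by exact: conjc_real.
have ACh : AC \is hermsymmx.
  rewrite qualifE /= expr0 scale1r; apply/eqP/matrixP => i j; rewrite !mxE.
  by rewrite -{1}(symmx_tr A) mxE conjR.
have /orthomx_spectralP ACE := hermitian_normalmx ACh.
have /mxOverP dR := hermitian_spectral_diag_real ACh.
pose d := spectral_diag AC.
pose s0 := [seq complex.Re (d 0 i) | i <- enum 'I_n].
exists (sort >=%R s0); split.
  by apply: sort_sorted => x y; exact: ge_total.
apply: (map_poly_inj iota).
rewrite (perm_big s0) /=; last by rewrite perm_sort.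
rewrite big_map rmorph_prod /= map_char_poly -/AC.
have -> : char_poly AC = char_poly (diag_mx d).
  set P := spectralmx AC in ACE; rewrite {1}ACE /char_poly /char_poly_mx.
  set PX := map_mx polyC P.
  have PXu : PX \in unitmx by rewrite map_unitmx spectral_unit.
  have -> : 'X%:M - map_mx polyC (invmx P *m diag_mx d *m P) =
      invmx PX *m ('X%:M - map_mx polyC (diag_mx d)) *m PX.
    rewrite !map_mxM map_invmx -/PX mulmxBr mulmxBl; congr (_ - _).
    by rewrite -mulmxA -scalar_mxC mulKmx.
  by rewrite !det_mulmx det_inv mulrAC mulVr ?mul1r // -unitmxE.
rewrite char_poly_trig ?diag_mx_is_trig // big_enum /=.
apply: eq_bigr => i _; rewrite mxE eqxx mulr1n rmorphB /= map_polyX map_polyC /=.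
by rewrite /iota RRe_real.
Qed.
End Spectrum.

Section Gradient.
Variables (R : realType) (n : nat).
Local Notation S := (symmx R n).

Fact sym_part_subproof (M : 'M[R]_n) : 2^-1 *: (M + M^T) \is symmetricmx.
Proof.
rewrite qualifE /= expr0 scale1r map_mx_id //.
by rewrite linearZ /= [(_ + _)^T]linearD /= trmxK addrC.
Qed.
Let sym_part M : S := SymMx (sym_part_subproof M).

Lemma sym_dot_riesz (u : {linear S -> R^o}) :
  exists G : S, forall H : S, u H = sym_dot G H.
Proof.
pose g := \matrix_(i, j) u (sym_part (delta_mx i j)).
have gsym : g \is symmetricmx.
  rewrite qualifE /= expr0 scale1r map_mx_id //; apply/eqP/matrixP => i j.
  rewrite !mxE; congr (u _); apply: val_inj => /=.
  by rewrite !trmx_delta addrC.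
exists (SymMx gsym) => H; rewrite sym_dotE.
have HS : H = \sum_i \sum_j H i j *: sym_part (delta_mx i j).
  have valsum (F : 'I_n -> S) :
      symmx_val (\sum_i F i) = \sum_i symmx_val (F i).
    exact: (big_morph (@symmx_val R n) (fun _ _ : S => erefl) erefl).
  apply: val_inj; rewrite /= valsum; under eq_bigr do rewrite valsum /=.
  have HE := matrix_sum_delta (H : 'M[R]_n).
  transitivity (2^-1 *: ((H : 'M[R]_n) + (H : 'M[R]_n)^T)).
    by rewrite symmx_tr; apply/matrixP => i j; rewrite !mxE; field.
  rewrite {1 2}HE linear_sum -big_split scaler_sumr /=.
  apply: eq_bigr => i _; rewrite linear_sum -big_split scaler_sumr /=.
  apply: eq_bigr => j _; rewrite linearZ /= -scalerDr !scalerA.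
  by rewrite mulrC.
rewrite {1}HS linear_sum; apply: eq_bigr => i _.
rewrite linear_sum; apply: eq_bigr => j _.
by rewrite linearZ /= mxE mulrC.
Qed.

(* The Riesz representative of the Frechet differential for sym_dot (gradP). *)
Definition grad (f : S -> R^o) (X : S) : S :=
  get [set G : S | forall H, 'd f X H = sym_dot G H].

Lemma gradP (f : S -> R^o) (X H : S) : 'd f X H = sym_dot (grad f X) H.
Proof.
have [G GE] := sym_dot_riesz ('d f X).
pose P := [set G' : S | forall H, 'd f X H = sym_dot G' H].
exact: (@getPex _ P (ex_intro P G GE)).
Qed.

End Gradient.

Section FantopeProblem.
Variables (R : realType) (n k : nat).
Implicit Types (f : symmx R n -> R^o) (X Y Z : symmx R n).
Local Notation I := (@symmx1 R n).

Definition fantope : set (symmx R n) :=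
  [set X | psd (I - X) /\ psd X /\ \tr X = k%:R].

Definition convex_on_symmx f : Prop :=
  @convex_function R (symmx R n) setT f.

Definition smooth (beta : R) f : Prop :=
  forall X Y, `|grad f X - grad f Y| <= beta * `|X - Y|.

Definition optimal f X : Prop :=
  fantope X /\ forall Y, fantope Y -> f X <= f Y.

(* (X, (Z1, Z2, s)) is an optimal primal-dual pair for the Lagrangian
   f(X) - <Z1, X> - <Z2, I - X> - s (tr X - k). *)
Definition KKT f X Z1 Z2 (s : R) : Prop :=
  [/\ fantope X, psd Z1 /\ psd Z2,
      grad f X = Z1 - Z2 + s *: I,
      sym_dot Z1 X = 0 & sym_dot Z2 (I - X) = 0].

Definition colrange (A : symmx R n) : set 'cV[R]_n :=
  range (fun v : 'cV[R]_n => A *m v).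

Definition nullspace (A : symmx R n) : set 'cV[R]_n :=
  [set v | A *m v = 0].

Definition strict_complementarity X Z1 Z2 : Prop :=
  colrange X = nullspace Z1 \/ colrange (I - X) = nullspace Z2.

End FantopeProblem.

(* Main.v *)
Require Import Defs.
From mathcomp Require Import all_boot all_order all_algebra.
From mathcomp Require Import boolp classical_sets reals topology normedtype derive.
From mathcomp Require Import sesquilinear ring.

(** The KKT conditions give Z1 X = 0 and Z2 (I - X) = 0, so the quadratic form
    of G = grad f X is s|v|^2 + v Z1 v^T on ker X and on ker Z2, and
    s|v|^2 - v Z2 v^T on range X and on ker Z1.  If rank X = k, these bounds on
    ker X and range X squeeze s between the (n-k)-th and (n-k+1)-th eigenvalue
    of G (Courant-Fischer), and strict complementarity makes one of the two
    inequalities strict.  Conversely, a gap puts s strictly below the first or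
    strictly above the second of these eigenvalues; then the bound on ker Z1
    (resp. ker Z2) limits its dimension to that of range X
    (resp. range (I - X)), which it contains.  The real spectral theorem is
    proved by deflation with Householder reflections. *)

Set Implicit Arguments.
Unset Strict Implicit.
Unset Printing Implicit Defensive.

Import Order.TTheory GRing.Theory Num.Theory.
Import numFieldNormedType.Exports.

Local Open Scope ring_scope.

(** * The real spectral theorem for symmetric matrices, in row-vector form *)

Section Spectral.
Context {R : realType}.

Lemma row_dot_ge0 n (v : 'rV[R]_n) : 0 <= (v *m v^T) 0 0.
Proof. by rewrite mxE sumr_ge0 // => i _; rewrite mxE -expr2 sqr_ge0. Qed.

Lemma row_dot_eq0 n (v : 'rV[R]_n) : (v *m v^T) 0 0 = 0 -> v = 0.
Proof.
rewrite mxE => /eqP; rewrite psumr_eq0 => [/allP v0|i _]; last first.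
  by rewrite mxE -expr2 sqr_ge0.
apply/rowP => i; have := v0 i (mem_index_enum _).
by rewrite !mxE /= mulf_eq0 orbb => /eqP.
Qed.

Lemma row_dot_gt0 n (v : 'rV[R]_n) : v != 0 -> 0 < (v *m v^T) 0 0.
Proof.
move=> v0; rewrite lt_def row_dot_ge0 andbT.
by apply: contraNN v0 => /eqP /row_dot_eq0 ->.
Qed.

Lemma gram_eq0 m n (M : 'M[R]_(m, n)) : \tr (M *m M^T) = 0 -> M = 0.
Proof.
have rowE i : (M *m M^T) i i = (row i M *m (row i M)^T) 0 0.
  by rewrite !mxE; apply: eq_bigr => j _; rewrite !mxE.
move=> /eqP; rewrite /mxtrace psumr_eq0 => [/allP M0|i _]; last first.
  by rewrite rowE row_dot_ge0.
apply/row_matrixP => i; rewrite row0; apply: row_dot_eq0.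
by apply/eqP; rewrite -rowE; exact: M0 (mem_index_enum _).
Qed.

(** For [u] different from [e], [H] is the reflection in the hyperplane orthogonal to [w = u - e],
    which swaps these two unit vectors. *)
Lemma householder n (u : 'rV[R]_n.+1) : u *m u^T = 1%:M ->
  exists H : 'M[R]_n.+1, [/\ H^T = H, H *m H = 1%:M & u *m H = delta_mx 0 0].
Proof.
move=> u1; set e : 'rV[R]_n.+1 := delta_mx 0 0.
have e1 : e *m e^T = 1%:M.
  by rewrite /e trmx_delta mul_delta_mx; apply/matrixP => i j; rewrite !ord1 !mxE.
have [->|ue] := eqVneq u e; first by exists 1%:M; rewrite trmx1 !mulmx1.
have [w wE] : exists w, w = u - e by exists (u - e).
pose q : R := (w *m w^T) 0 0; pose x : R := (u *m e^T) 0 0.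
have q0 : q != 0 by rewrite gt_eqF // row_dot_gt0 // wE subr_eq0.
have ux : u *m e^T = x%:M by rewrite [LHS]mx11_scalar.
have eu : e *m u^T = x%:M by rewrite -[LHS]trmxK trmx_mul trmxK ux tr_scalar_mx.
have ww : w *m w^T = q%:M by rewrite [LHS]mx11_scalar.
have uw : u *m w^T = (1 - x)%:M.
  by rewrite wE linearB /= mulmxBr u1 ux raddfB.
(* Since [u] and [e] are unit vectors, |u - e|^2 = 2 (1 - <u, e>); hence the reflection subtracts
   exactly [w] from [u]. *)
have qx : q = 2 * (1 - x).
  rewrite /q wE linearB /= mulmxBr !mulmxBl u1 e1 eu ux !mxE /=; ring.
exists (1%:M - (2 / q) *: (w^T *m w)); split.
- by rewrite linearB linearZ /= trmx1 trmx_mul trmxK.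
- rewrite mulmxBl mul1mx mulmxBr mulmx1 -scalemxAl -scalemxAr.
  rewrite mulmxA -(mulmxA w^T) ww mul_mx_scalar -scalemxAl !scalerA.
  rewrite -scalerBl -addrA -opprD -scalerDl (_ : 2 / q + _ = 0) ?scale0r ?subr0 //.
  by field.
- rewrite mulmxBr mulmx1 -scalemxAr mulmxA uw mul_scalar_mx scalerA.
  rewrite mulrAC -qx divff // scale1r wE opprB addrC subrK //.
Qed.

(** The characteristic polynomial splits over the reals and has positive degree, so a real root
    exists; its eigenvector is then normalized. *)
Lemma symmetric_eigenvector n (A : 'M[R]_n.+1) : A^T = A ->
  exists a (u : 'rV[R]_n.+1), u *m A = a *: u /\ u *m u^T = 1%:M.
Proof.
move=> As.
have As' : A \is symmetricmx by rewrite qualifE /= expr0 scale1r map_mx_id // As.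
have [_ /= AE] := eigenvaluesP (SymMx As').
case: (eigenvalues _) AE => [|a s] AE.
  by have := size_char_poly A; rewrite AE big_nil size_poly1.
have /eigenvalueP[v vA v0] : eigenvalue A a.
  by rewrite eigenvalue_root_char AE big_cons rootM root_XsubC eqxx.
pose q : R := (v *m v^T) 0 0; have q0 : 0 < q by exact: row_dot_gt0.
exists a, ((Num.sqrt q)^-1 *: v); split.
  by rewrite -scalemxAl vA !scalerA mulrC.
rewrite linearZ /= -scalemxAl -scalemxAr scalerA -invfM -expr2 sqr_sqrtr ?ltW //.
by rewrite [v *m _]mx11_scalar -/q scale_scalar_mx mulVf // gt_eqF.
Qed.

Lemma symmetric_spectral n (A : 'M[R]_n) : A^T = A ->
  exists (P : 'M[R]_n) (d : 'rV[R]_n),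
    P *m P^T = 1%:M /\ A = P^T *m diag_mx d *m P.
Proof.
elim: n A => [|n IH] A As.
  by exists 1%:M, 0; split; apply/matrixP; case.
have [a [u [uA u1]]] := symmetric_eigenvector As.
have [H [Hs HH uH]] := householder u1.
have [B Bdef] : exists B : 'M[R]_(1 + n), B = H *m A *m H by exists (H *m A *m H).
have Bs : B^T = B by rewrite Bdef !trmx_mul Hs As mulmxA.
(* Conjugation by [H] turns the eigenvector [u] into the first basis vector. This fixes the first
   row of [B], by symmetry also its first column, and leaves the block [B'] for the induction. *)
have B0 : (delta_mx 0 0 : 'rV_(1 + n)) *m B = a *: delta_mx 0 0.
  by rewrite -uH Bdef !mulmxA -(mulmxA u) HH mulmx1 uA -scalemxAl.
pose B' := drsubmx B.
have BE : B = block_mx a%:M 0 0 B'.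
  have l0 : lshift n 0 = 0 :> 'I_(1 + n) by exact: val_inj.
  have row0B j : B 0 j = a * (j == 0)%:R.
    by have /rowP/(_ j) := B0; rewrite -rowE !mxE eqxx.
  have ur : ursubmx B = 0.
    by apply/matrixP => i j; rewrite !mxE !ord1 l0 row0B mulr0.
  rewrite -[LHS]submxK -/B' ur; congr block_mx.
    by apply/matrixP => i j; rewrite !mxE !ord1 l0 row0B mulr1.
  by rewrite -[dlsubmx B]trmxK trmx_dlsub Bs ur trmx0.
have B's : B'^T = B' by rewrite /B' trmx_drsub Bs.
have [Q [d [QQ QE]]] := IH B' B's.
pose K : 'M[R]_(1 + n) := block_mx 1%:M 0 0 Q.
have KK : K *m K^T = 1%:M.
  rewrite /K tr_block_mx !trmx0 trmx1 mulmx_block QQ.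
  by rewrite !mulmx0 !mul0mx !mulmx1 !addr0 !add0r -scalar_mx_block.
have DE : diag_mx (row_mx a%:M d) = block_mx a%:M 0 0 (diag_mx d) :> 'M[R]_(1 + n).
  rewrite diag_mx_row; congr (block_mx _ 0 0 _).
  by apply/matrixP => i j; rewrite !ord1 !mxE eqxx.
have BK : B = K^T *m diag_mx (row_mx a%:M d) *m K.
  rewrite BE DE /K tr_block_mx !trmx0 trmx1 !mulmx_block.
  by rewrite !mulmx0 !mul0mx !mulmx1 !mul1mx !addr0 !add0r QE mul0mx.
exists (K *m H), (row_mx a%:M d); split.
  by rewrite trmx_mul Hs mulmxA -(mulmxA K) HH mulmx1.
have -> : A = H *m B *m H by rewrite Bdef !mulmxA HH mul1mx -mulmxA HH mulmx1.
by rewrite BK trmx_mul Hs !mulmxA.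
Qed.

End Spectral.

(** * Diagonalization matched with the list of eigenvalues *)

Section SymmetricSpectrum.
Context {R : realType} {n : nat}.
Implicit Types (A B X Z : symmx R n).

Lemma symmx_spectral A : exists (P : 'M[R]_n) (d : 'rV[R]_n),
  [/\ P *m P^T = 1%:M, P^T *m P = 1%:M, A = P^T *m diag_mx d *m P :> 'M_n
    & perm_eq (eigenvalues A) [seq d 0 i | i : 'I_n]].
Proof.
have [P [d [PP AE]]] := symmetric_spectral (symmx_tr A).
have PP' := mulmx1C PP.
exists P, d; split => //; apply: prod_XsubC_eq.
have [_ <-] := eigenvaluesP A.
transitivity (char_poly (diag_mx d)); last first.
  rewrite char_poly_trig ?diag_mx_is_trig // big_image /=.
  by apply: eq_bigr => i _; rewrite mxE eqxx.
rewrite AE /char_poly /char_poly_mx; set PX := map_mx polyC P.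
have PXX : PX^T *m PX = 1%:M by rewrite /PX matrix.map_trmx -map_mxM PP' map_mx1.
have -> : 'X%:M - map_mx polyC (P^T *m diag_mx d *m P) =
    PX^T *m ('X%:M - map_mx polyC (diag_mx d)) *m PX.
  rewrite !map_mxM -matrix.map_trmx -/PX mulmxBr mulmxBl; congr (_ - _).
  by rewrite mul_mx_scalar -scalemxAl PXX scalemx1.
by rewrite !det_mulmx mulrAC -det_mulmx PXX det1 mul1r.
Qed.

Lemma size_eigenvalues A : size (eigenvalues A) = n.
Proof.
have [P [d [_ _ _ /perm_size ->]]] := symmx_spectral A.
by rewrite size_map size_enum_ord.
Qed.

(* By a dimension count, some nonzero v in W is orthogonal to all eigenvectors
   whose eigenvalue satisfies p. *)
Lemma rank_gt_count A (p : pred R) m (W : 'M[R]_(m, n)) :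
    (count p (eigenvalues A) < \rank W)%N ->
  exists v : 'rV[R]_n, [/\ (v <= W)%MS, v != 0,
    forall a b, (forall x, ~~ p x -> 0 <= a * x + b) ->
      0 <= a * (v *m A *m v^T) 0 0 + b * (v *m v^T) 0 0
  & forall a b, (forall x, ~~ p x -> 0 < a * x + b) ->
      0 < a * (v *m A *m v^T) 0 0 + b * (v *m v^T) 0 0].
Proof.
have [P [d [PP PP' AE /permP ->]]] := symmx_spectral A.
rewrite count_map; set I := [pred i | p (d 0 i)] => ltW.
have {}ltW : (#|I| < \rank W)%N by rewrite cardE {1}/enum_mem size_filter -enumT.
(* Coordinates of a basis of [W] along the eigenvectors selected by [p]. There are more rows than
   columns, so the left kernel is nonzero and yields [v]. *)
pose M : 'M_(\rank W, #|I|) :=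
  \matrix_(i, j) (row_base W *m P^T) i (enum_val j).
have /rowV0Pn[x /sub_kermxP xM x0] : kermx M != 0.
  by rewrite -mxrank_eq0 mxrank_ker subn_eq0 -ltnNge (leq_ltn_trans (rank_leq_col M)).
pose v := x *m row_base W; pose w := v *m P^T.
have v0 : v != 0 by rewrite mulmx_free_eq0 ?row_base_free.
have vE : v = w *m P by rewrite /w -mulmxA PP' mulmx1.
have w0 i : p (d 0 i) -> w 0 i = 0.
  move=> pi; pose j := enum_rank_in (pi : i \in I) i.
  suff -> : w 0 i = (x *m M) 0 j by rewrite xM mxE.
  rewrite /w /v -mulmxA [LHS]mxE [RHS]mxE; apply: eq_bigr => l _.
  by rewrite [M l j]mxE enum_rankK_in.
have vW : (v <= W)%MS by rewrite (submx_trans (submxMl _ _)) ?eq_row_base.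
clearbody w; clearbody v.
(* In eigenvector coordinates both forms are diagonal, and only indices with [~~ p (d 0 i)]
   contribute. *)
have formE a b : a * (v *m A *m v^T) 0 0 + b * (v *m v^T) 0 0 =
    \sum_i (a * d 0 i + b) * w 0 i ^+ 2.
  have -> : v *m A *m v^T = w *m diag_mx d *m w^T.
    rewrite AE vE trmx_mul !mulmxA -(mulmxA w) PP mulmx1.
    by rewrite -(mulmxA (w *m _)) PP mulmx1.
  have -> : v *m v^T = w *m w^T.
    by rewrite vE trmx_mul mulmxA -(mulmxA w) PP mulmx1.
  rewrite mul_mx_diag [(w *m _) 0 0]mxE mxE !mulr_sumr -big_split.
  by apply: eq_bigr => i _; rewrite /= !mxE; ring.
exists v; split=> //.
  move=> a b ab; rewrite formE sumr_ge0 // => i _.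
  have [/w0 ->|/ab abi] := boolP (p (d 0 i)); first by rewrite expr0n mulr0.
  by rewrite mulr_ge0 ?sqr_ge0.
move=> a b ab; rewrite formE.
have term i : 0 <= (a * d 0 i + b) * w 0 i ^+ 2 ?= iff (w 0 i == 0).
  have [->|wi0] := eqVneq (w 0 i) 0; first by rewrite expr0n mulr0; apply/leifP.
  apply/leifP; rewrite mulr_gt0 ?exprn_even_gt0 // ab //.
  by apply: contraNN wi0 => /w0 ->.
rewrite lt_def sumr_ge0 ?andbT => [|i _]; last exact: (term i).1.
apply: contra v0 => /eqP/psumr_eq0P s0; suff w00 : w = 0 by rewrite vE w00 mul0mx.
apply/rowP => i; rewrite mxE; apply/eqP; rewrite -(term i).2 eq_sym s0 //.
by move=> j _; exact: (term j).1.
Qed.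
End SymmetricSpectrum.

(** * Counting entries of a nonincreasing sequence *)

Section SortedCount.
Context {R : realType}.
Implicit Types (s : seq R) (p : pred R).

Lemma sorted_ge_nth s i j : sorted >=%R s -> (i <= j < size s)%N ->
  nth 0 s j <= nth 0 s i.
Proof.
move=> ss /andP[ij js].
apply: (sorted_leq_nth (leT := >=%R)) => //; last exact: leq_ltn_trans js.
  by move=> y x z /= yx zy; exact: le_trans zy yx.
by move=> x /=.
Qed.

(** Failure of the upward closed [p] at index [j] spreads to all later, smaller entries, leaving
    only the first [j]. For [j] past the end the bound is just the size of [s]. *)
Lemma count_sorted_up s p j : sorted >=%R s ->
  (forall x y, x <= y -> p x -> p y) -> ~~ p (nth 0 s j) -> (count p s <= j)%N.
Proof.
move=> ss p_up pj; rewrite -(cat_take_drop j s) count_cat.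
rewrite [X in (_ + X)%N](_ : _ = 0%N) ?addn0.
  by rewrite (leq_trans (count_size _ _)) // size_take; case: ltnP.
apply/eqP; rewrite -leqn0 leqNgt -has_count; apply: contra pj.
move=> /(has_nthP 0)[i]; rewrite size_drop nth_drop => i_s; apply: p_up.
by apply: sorted_ge_nth => //; rewrite leq_addr -ltn_subRL.
Qed.

Lemma count_sorted_down s p j : sorted >=%R s -> (j < size s)%N ->
  (forall x y, x <= y -> p y -> p x) -> ~~ p (nth 0 s j) ->
  (count p s <= size s - j.+1)%N.
Proof.
move=> ss js p_down pj; rewrite -{1}(cat_take_drop j.+1 s) count_cat.
rewrite [X in (X + _)%N](_ : _ = 0%N) ?add0n.
  by rewrite -size_drop count_size.
apply/eqP; rewrite -leqn0 leqNgt -has_count; apply: contra pj.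
move=> /(has_nthP 0)[i]; rewrite size_takel // => ij; rewrite nth_take //.
by apply: p_down; apply: sorted_ge_nth; rewrite // js andbT -ltnS.
Qed.
End SortedCount.

(** * Positive semidefinite matrices, ranks in the Fantope, and Courant-Fischer bounds *)

Section Psd.
Context {R : realType} {n : nat}.
Implicit Types (A B X Z : symmx R n).

Lemma psd_row A (v : 'rV[R]_n) : psd A -> 0 <= (v *m A *m v^T) 0 0.
Proof. by move=> /(_ v^T); rewrite trmxK. Qed.

Lemma form_rowE m (P : 'M[R]_(m, n)) (A : 'M[R]_n) i :
  (row i P *m A *m (row i P)^T) 0 0 = (P *m A *m P^T) i i.
Proof. by rewrite -row_mul !mxE; apply: eq_bigr => j _; rewrite !mxE. Qed.

Lemma psd_spectral_ge0 A (P : 'M[R]_n) (d : 'rV[R]_n) : psd A ->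
  P *m P^T = 1%:M -> A = P^T *m diag_mx d *m P :> 'M_n -> forall i, 0 <= d 0 i.
Proof.
move=> A0 PP AE i; have := psd_row (row i P) A0.
by rewrite form_rowE AE !mulmxA PP mul1mx -mulmxA PP mulmx1 mxE eqxx.
Qed.

Lemma psd_sqrt A : psd A ->
  exists S : 'M[R]_n, S^T = S /\ A = S *m S :> 'M_n.
Proof.
move=> A0; have [P [d [PP PP' AE _]]] := symmx_spectral A.
have d0 := psd_spectral_ge0 A0 PP AE.
pose e := \row_i Num.sqrt (d 0 i).
exists (P^T *m diag_mx e *m P); split.
  by rewrite !trmx_mul trmxK tr_diag_mx mulmxA.
rewrite AE !mulmxA -(mulmxA (P^T *m _) P) PP mulmx1 -(mulmxA P^T (diag_mx e)).
congr (_ *m _ *m _); rewrite mulmx_diag; congr diag_mx; apply/rowP => i.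
by rewrite !mxE -expr2 sqr_sqrtr.
Qed.

(** With a symmetric square root [S] of [A], the form at [v] is |v S|^2. *)
Lemma psd_form_eq0 A (v : 'rV[R]_n) : psd A -> (v *m A *m v^T) 0 0 = 0 -> v *m A = 0.
Proof.
move=> /psd_sqrt[S [Ss AE]] vAv.
suff vS : v *m S = 0 by rewrite AE mulmxA vS mul0mx.
by apply: row_dot_eq0; rewrite trmx_mul Ss mulmxA -(mulmxA v) -AE.
Qed.

(** With square roots [S] and [T], the trace of [A *m B] is the squared Frobenius norm of [S *m T].
    This turns complementary slackness into matrix equations. *)
Lemma psd_dot_eq0 A B : psd A -> psd B -> sym_dot A B = 0 -> A *m B = 0.
Proof.
move=> /psd_sqrt[S [Ss AE]] /psd_sqrt[T [Ts BE]].
rewrite /sym_dot AE BE => AB0; suff ST : S *m T = 0.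
  by rewrite mulmxA -(mulmxA S) ST mulmx0 mul0mx.
apply: gram_eq0; rewrite trmx_mul Ss Ts mulmxA mxtrace_mulC.
by rewrite -AB0 !mulmxA.
Qed.

Lemma tr_mul_symmx A B : (A *m B)^T = B *m A :> 'M_n.
Proof. by rewrite trmx_mul !symmx_tr. Qed.

(** The product gives one inclusion, and the ranks leave no room for a larger null space.
    Transposition passes between columns and the row spaces of [submx]. *)
Lemma colrange_nullspace A B : A *m B = 0 -> (n <= \rank A + \rank B)%N ->
  colrange A = nullspace B.
Proof.
move=> AB0 rAB; rewrite /colrange /nullspace eqEsubset; split=> v /=.
  by move=> [y _ <-]; rewrite mulmxA -tr_mul_symmx AB0 trmx0 mul0mx.
move=> Bv; have AK : (A <= kermx B)%MS by exact/sub_kermxP.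
have KA : (kermx B <= A)%MS.
  by rewrite -(geq_leqif (mxrank_leqif_sup AK)) mxrank_ker leq_subLR addnC.
have : (v^T <= kermx B)%MS.
  by apply/sub_kermxP; rewrite -[LHS]trmxK trmx_mul trmxK symmx_tr Bv trmx0.
move=> /submx_trans/(_ KA)/submxP[y vE]; exists y^T => //.
by rewrite -[LHS]trmxK trmx_mul trmxK symmx_tr -vE trmxK.
Qed.

(** If the kernel had dimension above the number of nonpositive eigenvalues, it would contain a
    vector with positive form. *)
Lemma count_pos_le_rank A :
  (count (fun x : R => (0 < x)%R) (eigenvalues A) <= \rank A)%N.
Proof.
pose p := fun x : R => x <= 0.
have -> : count (fun x : R => (0 < x)%R) (eigenvalues A) = count (predC p) (eigenvalues A).
  by apply: eq_count => x; rewrite /= -ltNge.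
have := count_predC p (eigenvalues A); rewrite size_eigenvalues.
suff : (\rank (kermx A) <= count p (eigenvalues A))%N.
  by rewrite mxrank_ker leq_subLR => + E; rewrite -{1}E addnC leq_add2r.
rewrite leqNgt; apply/negP => /rank_gt_count[v [/sub_kermxP vA v0 _ H]].
have /H : forall x, ~~ p x -> 0 < 1 * x + 0.
  by move=> x; rewrite mul1r addr0 /p -ltNge.
by rewrite vA mul0mx mxE mulr0 mul0r addr0 ltxx.
Qed.

(** The eigenvalues lie in [0, 1] and sum to [k], so at least [k] are positive. If the rank is [k],
    exactly [k] are positive and all of these equal 1, so [X] is a projection. *)
Lemma fantope_rank k X : fantope k X ->
  (k <= \rank X)%N /\ (\rank X = k -> X *m X = X).
Proof.
move=> [IX0 [X0 trX]].
have [P [d [PP PP' XE sX]]] := symmx_spectral X.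
have d0 := psd_spectral_ge0 X0 PP XE.
have d1 i : d 0 i <= 1.
  have := psd_row (row i P) IX0; rewrite form_rowE /= mulmxBr mulmx1 mulmxBl PP.
  by rewrite XE !mulmxA PP mul1mx -mulmxA PP mulmx1 !mxE eqxx subr_ge0.
have kE : k%:R = \sum_i d 0 i.
  by rewrite -trX XE mxtrace_mulC mulmxA PP mul1mx mxtrace_diag.
pose c := count (fun x : R => (0 < x)%R) (eigenvalues X).
have cE : c%:R = \sum_i (0 < d 0 i)%R%:R :> R.
  rewrite /c (permP sX) count_map -sum1_count big_enum_cond big_mkcond natr_sum.
  by apply: eq_bigr => i _ /=; case: ifP.
have dc i : d 0 i <= (0 < d 0 i)%R%:R ?= iff (d 0 i == (0 < d 0 i)%R%:R).
  split=> //; have := d0 i; rewrite le_eqVlt => /orP[/eqP <-|di].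
    by rewrite ltxx.
  by rewrite di d1.
(* [kcE] is the equality case: the sums agree only if every eigenvalue equals its 0-1 indicator of
   positivity. *)
have [kc kcE] := leif_sum (fun i (_ : true) => dc i).
have cX : (c <= \rank X)%N := count_pos_le_rank X.
have kc' : (k <= c)%N by rewrite -(ler_nat R) kE cE.
split; first exact: leq_trans cX.
move=> rX; have ck : c = k by apply/eqP; rewrite eqn_leq kc' -rX cX.
move: kcE; rewrite -kE -cE ck eqxx => /esym/forallP dE.
have DD : diag_mx d *m diag_mx d = diag_mx d.
  rewrite mulmx_diag; congr diag_mx; apply/rowP => i; rewrite mxE.
  by rewrite (eqP (dE i)); case: (0 < _); rewrite ?mulr0 ?mulr1.
by rewrite XE !mulmxA -(mulmxA (P^T *m _) P) PP mulmx1 -(mulmxA P^T (diag_mx d)) DD.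
Qed.

(** Otherwise at most [i - 1] eigenvalues exceed [s], and [W] contains a nonzero vector orthogonal
    to their eigenvectors, where the form is at most s|v|^2. *)
Lemma lambda_gt A (s : R) i m (W : 'M[R]_(m, n)) : (0 < i <= \rank W)%N ->
  (forall v : 'rV_n, (v <= W)%MS -> v != 0 ->
    s * (v *m v^T) 0 0 < (v *m A *m v^T) 0 0) ->
  s < lambda_ i A.
Proof.
move=> /andP[i0 iW] AW; apply/negPn/negP => lei.
have [sA _] := eigenvaluesP A.
have : (count (> s)%R (eigenvalues A) <= i.-1)%N.
  by apply: count_sorted_up => // x y xy sx; exact: lt_le_trans xy.
rewrite -ltnS prednK // => /leq_trans/(_ iW)/rank_gt_count[v [vW v0 H _]].
have /H : forall x, ~~ (s < x) -> 0 <= -1 * x + s.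
  by move=> x; rewrite -leNgt mulN1r addrC subr_ge0.
by apply/negP; rewrite -ltNge mulN1r addrC subr_lt0 AW.
Qed.

Lemma lambda_ge A (s : R) i m (W : 'M[R]_(m, n)) : (0 < i <= \rank W)%N ->
  (forall v : 'rV_n, (v <= W)%MS -> s * (v *m v^T) 0 0 <= (v *m A *m v^T) 0 0) ->
  s <= lambda_ i A.
Proof.
move=> /andP[i0 iW] AW; apply/negPn/negP => lei.
have [sA _] := eigenvaluesP A.
have : (count (>= s)%R (eigenvalues A) <= i.-1)%N.
  by apply: count_sorted_up => // x y xy sx; exact: le_trans xy.
rewrite -ltnS prednK // => /leq_trans/(_ iW)/rank_gt_count[v [vW v0 _ H]].
have /H : forall x, ~~ (s <= x) -> 0 < -1 * x + s.
  by move=> x; rewrite -ltNge mulN1r addrC subr_gt0.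
by apply/negP; rewrite -leNgt mulN1r addrC subr_le0 AW.
Qed.

(** Otherwise at most [n - i] eigenvalues lie below [s], so some nonzero vector of [W] avoids their
    eigenvectors and has form at least s|v|^2. *)
Lemma lambda_lt A (s : R) i m (W : 'M[R]_(m, n)) :
  (0 < i <= n)%N -> (n - i < \rank W)%N ->
  (forall v : 'rV_n, (v <= W)%MS -> v != 0 ->
    (v *m A *m v^T) 0 0 < s * (v *m v^T) 0 0) ->
  lambda_ i A < s.
Proof.
move=> /andP[i0 ile] iW AW; apply/negPn/negP => lei.
have [sA _] := eigenvaluesP A.
have : (count (< s)%R (eigenvalues A) <= size (eigenvalues A) - i.-1.+1)%N.
  apply: count_sorted_down => //; first by rewrite size_eigenvalues prednK.
  by move=> x y xy; exact: le_lt_trans.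
rewrite size_eigenvalues prednK // => /leq_ltn_trans/(_ iW)/rank_gt_count[v [vW v0 H _]].
have /H : forall x, ~~ (x < s) -> 0 <= 1 * x + - s.
  by move=> x; rewrite -leNgt mul1r subr_ge0.
by apply/negP; rewrite -ltNge mul1r mulNr subr_lt0 AW.
Qed.

Lemma lambda_le A (s : R) i m (W : 'M[R]_(m, n)) :
  (0 < i <= n)%N -> (n - i < \rank W)%N ->
  (forall v : 'rV_n, (v <= W)%MS -> (v *m A *m v^T) 0 0 <= s * (v *m v^T) 0 0) ->
  lambda_ i A <= s.
Proof.
move=> /andP[i0 ile] iW AW; apply/negPn/negP => lei.
have [sA _] := eigenvaluesP A.
have : (count (<= s)%R (eigenvalues A) <= size (eigenvalues A) - i.-1.+1)%N.
  apply: count_sorted_down => //; first by rewrite size_eigenvalues prednK.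
  by move=> x y xy; exact: le_trans.
rewrite size_eigenvalues prednK // => /leq_ltn_trans/(_ iW)/rank_gt_count[v [vW v0 _ H]].
have /H : forall x, ~~ (x <= s) -> 0 < 1 * x + - s.
  by move=> x; rewrite -ltNge mul1r subr_gt0.
by apply/negP; rewrite -leNgt mul1r mulNr subr_le0 AW.
Qed.

End Psd.

(** * The spectrum of the gradient at a KKT point, and both implications *)

Section KKTSpectrum.
Context {R : realType} {n : nat}.
Implicit Types (X Z : symmx R n) (v : 'rV[R]_n).

(** Through this symmetry [fantope_rank] also bounds the rank of [I - X] from below. *)
Lemma fantope_compl k X : (k <= n)%N -> fantope k X ->
  fantope (n - k) (symmx1 R n - X).
Proof.
move=> kn [IX0 [X0 trX]]; split; first by rewrite subKr.
by split=> //; rewrite /= linearB /= trX mxtrace1 natrB.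
Qed.

Variables (k : nat) (f : symmx R n -> R^o) (X Z1 Z2 : symmx R n) (s : R).
Hypothesis kkt : KKT k f X Z1 Z2 s.
Local Notation G := (grad f X).
Local Notation Y := (symmx1 R n - X).

Lemma KKT_mulZ1X : Z1 *m X = 0.
Proof. by case: kkt => -[_ [X0 _]] [Z10 _] _ ZX _; exact: psd_dot_eq0. Qed.

Lemma KKT_mulZ2Y : Z2 *m Y = 0.
Proof. by case: kkt => -[Y0 _] [_ Z20] _ _ ZY; exact: psd_dot_eq0. Qed.

Lemma KKT_formE v : (v *m G *m v^T) 0 0 =
  (v *m Z1 *m v^T) 0 0 - (v *m Z2 *m v^T) 0 0 + s * (v *m v^T) 0 0.
Proof.
case: kkt => _ _ -> _ _ /=.
by rewrite mulmxDr mulmxBr -scalemxAr mulmx1 mulmxDl mulmxBl -scalemxAl !mxE.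
Qed.

Lemma KKT_form_kerZ1 v : v *m Z1 = 0 ->
  (v *m G *m v^T) 0 0 = s * (v *m v^T) 0 0 - (v *m Z2 *m v^T) 0 0.
Proof. by move=> vZ; rewrite KKT_formE vZ mul0mx mxE add0r addrC. Qed.

Lemma KKT_form_kerZ2 v : v *m Z2 = 0 ->
  (v *m G *m v^T) 0 0 = s * (v *m v^T) 0 0 + (v *m Z1 *m v^T) 0 0.
Proof. by move=> vZ; rewrite KKT_formE vZ mul0mx [X in _ - X]mxE subr0 addrC. Qed.

Lemma KKT_kerX_kerZ2 v : v *m X = 0 -> v *m Z2 = 0.
Proof.
move=> vX; have -> : v = v *m Y by rewrite /= mulmxBr vX mulmx1 subr0.
by rewrite -mulmxA -tr_mul_symmx KKT_mulZ2Y trmx0 mulmx0.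
Qed.

Lemma KKT_rangeX_kerZ1 v : (v <= X)%MS -> v *m Z1 = 0.
Proof.
by move=> /submxP[u ->]; rewrite -mulmxA -tr_mul_symmx KKT_mulZ1X trmx0 mulmx0.
Qed.

Lemma strict_complementarity_gap : (1 <= k < n)%N -> \rank X = k ->
  strict_complementarity X Z1 Z2 -> lambda_ (n - k + 1) G < lambda_ (n - k) G.
Proof.
move=> /andP[k0 kn] rX sc.
have [Xk [Z10 Z20] _ _ _] := kkt.
have XX := (fantope_rank Xk).2 rX.
(* The kernel of [X], of dimension [n - k], tests [lambda_ (n - k)]; the range, of dimension [k],
   tests [lambda_ (n - k + 1)]. *)
have hi : (0 < n - k <= \rank (kermx X))%N.
  by rewrite mxrank_ker rX subn_gt0 kn /=.
have lo1 : (0 < n - k + 1 <= n)%N by rewrite addn1 /= ltn_subrL k0 (ltn_trans k0 kn).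
have lo2 : (n - (n - k + 1) < \rank X)%N.
  by rewrite rX subnDA (subKn (ltnW kn)) subn1 prednK.
case: sc => sc.
  (* Here ker Z1 is range X, which meets ker X only in 0, so the form of [Z1] is positive on nonzero
     vectors of ker X. *)
  have : s < lambda_ (n - k) G.
    apply: (lambda_gt hi) => v /sub_kermxP vX v0.
    rewrite KKT_form_kerZ2 ?KKT_kerX_kerZ2 // ltrDl lt_def psd_row // andbT.
    apply: contra v0 => /eqP/(psd_form_eq0 Z10) vZ.
    have : nullspace Z1 v^T.
      by rewrite /nullspace /= -[LHS]trmxK trmx_mul trmxK symmx_tr vZ trmx0.
    rewrite -sc => -[y _ yE]; apply/eqP/row_dot_eq0.
    by rewrite -yE mulmxA vX mul0mx mxE.
  apply: le_lt_trans; apply: (lambda_le lo1 lo2) => v vX.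
  by rewrite KKT_form_kerZ1 ?KKT_rangeX_kerZ1 // lerBlDr lerDl psd_row.
(* Here ker Z2 is range (I - X), and the strict inequality moves to the upper bound on
   [lambda_ (n - k + 1)]. *)
have : s <= lambda_ (n - k) G.
  apply: (lambda_ge hi) => v /sub_kermxP vX.
  by rewrite KKT_form_kerZ2 ?KKT_kerX_kerZ2 // lerDl psd_row.
apply: lt_le_trans; apply: (lambda_lt lo1 lo2) => v vX v0.
rewrite KKT_form_kerZ1 ?KKT_rangeX_kerZ1 // ltrBlDr ltrDl lt_def psd_row // andbT.
apply: contra v0 => /eqP/(psd_form_eq0 Z20) vZ.
have : nullspace Z2 v^T.
  by rewrite /nullspace /= -[LHS]trmxK trmx_mul trmxK symmx_tr vZ trmx0.
rewrite -sc => -[y _ yE]; move: vX => /submxP[u vE].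
apply/eqP/row_dot_eq0.
(* As [X] is a projection, X (I - X) = 0, so |v|^2 = u X (I - X) y = 0. *)
by rewrite -yE vE -!mulmxA (mulmxA _ _ y) /= mulmxBr mulmx1 XX subrr mul0mx mulmx0 mxE.
Qed.

Lemma gap_strict_complementarity : (1 <= k < n)%N ->
  lambda_ (n - k + 1) G < lambda_ (n - k) G -> strict_complementarity X Z1 Z2.
Proof.
move=> /andP[k0 kn] gap.
have [Xk [Z10 Z20] _ _ _] := kkt.
have rX := (fantope_rank Xk).1.
have rY := (fantope_rank (fantope_compl (ltnW kn) Xk)).1.
(* In the second case the gap gives [lambda_ (n - k + 1) G < s]. *)
have [sl|ls] := ltP s (lambda_ (n - k) G); [left|right].
  apply: colrange_nullspace; first by rewrite -tr_mul_symmx KKT_mulZ1X trmx0.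
  suff rZ : (n - k <= \rank Z1)%N.
    by rewrite (leq_trans _ (leq_add rX rZ)) // subnKC // ltnW.
  (* Were the rank of [Z1] below [n - k], ker Z1 would have dimension above [k], and the form is at
     most s|v|^2 there, forcing [lambda_ (n - k) G <= s]. *)
  rewrite leqNgt; apply: contraL sl => rZ; rewrite -leNgt.
  apply: (@lambda_le _ _ _ _ _ _ (kermx Z1)).
  - by rewrite subn_gt0 kn leq_subr.
  - by rewrite mxrank_ker ltn_sub2l // (leq_trans rZ) ?leq_subr.
  move=> v /sub_kermxP vZ.
  by rewrite KKT_form_kerZ1 // lerBlDr lerDl psd_row.
apply: colrange_nullspace; first by rewrite -tr_mul_symmx KKT_mulZ2Y trmx0.
suff rZ : (k <= \rank Z2)%N.
  by rewrite (leq_trans _ (leq_add rY rZ)) // subnK // ltnW.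
(* Were the rank of [Z2] below [k], ker Z2 would have dimension at least [n - k + 1], and the form
   is at least s|v|^2 there, forcing [s <= lambda_ (n - k + 1) G]. *)
rewrite leqNgt; apply/negP => rZ.
have := lt_le_trans gap ls.
apply/negP; rewrite -leNgt.
apply: (@lambda_ge _ _ _ _ _ _ (kermx Z2)).
  by rewrite addn1 /= mxrank_ker ltn_sub2l // (ltn_trans rZ).
move=> v /sub_kermxP vZ.
by rewrite KKT_form_kerZ2 // lerDl psd_row.
Qed.

End KKTSpectrum.

Theorem theorem2 (R : realType) (n k : nat) (hk : (1 <= k)%N) (hkn : (k < n)%N)
    (f : symmx R n -> R^o) (beta : R)
    (f_convex : convex_on_symmx f)
    (f_diff : forall X : symmx R n, differentiable f X)
    (beta_gt0 : 0 < beta) (f_smooth : smooth beta f) :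
  (forall X : symmx R n, optimal k f X -> \rank X = k ->
     (exists (Z1 Z2 : symmx R n) (s : R),
        KKT k f X Z1 Z2 s /\ strict_complementarity X Z1 Z2) ->
     0 < lambda_ (n - k) (grad f X) - lambda_ (n - k + 1) (grad f X)) /\
  (forall X : symmx R n, optimal k f X ->
     0 < lambda_ (n - k) (grad f X) - lambda_ (n - k + 1) (grad f X) ->
     forall (Z1 Z2 : symmx R n) (s : R),
       KKT k f X Z1 Z2 s -> strict_complementarity X Z1 Z2).
Proof.
have kn : (1 <= k < n)%N by rewrite hk.
split=> [X _ rX [Z1 [Z2 [s [kkt sc]]]]|X _ gap Z1 Z2 s kkt].
  by rewrite subr_gt0; exact: strict_complementarity_gap kkt kn rX sc.
by apply: gap_strict_complementarity kkt kn _; rewrite -subr_gt0.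
Qed.
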